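(* Let $u^n$ and $u^{n+1}$ denote two Gaussian wave packets with parameters $(q^n,v^n,Q^n,\Upsilon^n,\zeta^n)$ and $(q^{n+1},v^{n+1},Q^{n+1},\Upsilon^{n+1},\zeta^{n+1})$, respectively, and write $\zeta_{\mathrm I}=\operatorname{Im}\zeta$. Then the relation $$\zeta_{\mathrm I}^{n+1}=\zeta_{\mathrm I}^n+\frac\varepsilon2\bigl(\ln|\det Q^{n+1}|-\ln|\det Q^n|\bigr)$$ is equivalent to $$\|u^n\|_{L^2}=\|u^{n+1}\|_{L^2}.$$
   Context: Let $d\ge1$, $\varepsilon>0$. A Gaussian wave packet on $\mathbb R^d$ is $u(x)=\exp\bigl(\frac{\mathrm i}{\varepsilon}(\frac12(x-q)^\top\mathcal C(x-q)+(x-q)^\top p+\zeta)\bigr)$ with $q,p\in\mathbb R^d$, $\mathcal C=\mathcal C^\top\in\mathbb C^{d\times d}$ with positive definite componentwise imaginary part $\mathcal C_{\mathrm I}$, and $\zeta\in\mathbb C$. The width matrix is written in Hagedorn's parametrisation $\mathcal C=PQ^{-1}$, $\mathcal C_{\mathrm I}=(QQ^* )^{-1}$ with invertible $Q,P\in\mathbb C^{d\times d}$ satisfying $Q^\top P-P^\top Q=0$ and $Q^*P-P^*Q=2\mathrm i\,\mathrm{Id}$. The parameters $(q,v,Q,\Upsilon,\zeta)$ replace $(q,p,Q,P,\zeta)$ via the averaged magnetic momenta $v=p-\langle A\rangle_u$ and $\Upsilon=P-\langle J_A\rangle_uQ$, where $A:\mathbb R^d\to\mathbb R^d$ is the magnetic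 vector potential, $J_A=(\partial_\ell A_k)_{k,\ell}$ its Jacobi matrix, and $\langle a\rangle_u=\int_{\mathbb R^d}a|u|^2dx$ (entrywise). *)

(* Defs.v *)
From HB Require Import structures.
From mathcomp Require Import all_boot all_order all_algebra.
From mathcomp Require Import complex.
From mathcomp Require Import all_classical all_reals all_analysis.

Set Implicit Arguments.
Unset Strict Implicit.
Unset Printing Implicit Defensive.

Import Order.TTheory GRing.Theory Num.Theory.
Import numFieldNormedType.Exports.

Local Open Scope classical_set_scope.
Local Open Scope ring_scope.
Local Open Scope complex_scope.
Local Open Scope sesquilinear_scope.

(* Points of R^d are column vectors. The library puts a product sigma-algebra
   on tuples, not on matrices, so Lebesgue measure lives on d.-tuple R and
   functions on 'cV[R]_d are integrated through [colt]. *)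
Section lebesgue_tuple.
Context {R : realType}.
Local Notation RT := (measurableTypeR R).

Definition colt (d : nat) (t : d.-tuple RT) : 'cV[R]_d := \col_i tnth t i.

Definition tcons (d : nat) (xt : RT * d.-tuple RT) : d.+1.-tuple RT :=
  [tuple of xt.1 :: xt.2].

Lemma measurable_tcons (d : nat) : measurable_fun [set: RT * d.-tuple RT] (@tcons d).
Proof.
by apply: measurable_cons; [exact: measurable_fst|exact: measurable_snd].
Qed.

Section lebS.
Context (d : nat) (m : {sigma_finite_measure set (d.-tuple RT) -> \bar R}).

Definition lebS : set (d.+1.-tuple RT) -> \bar R :=
  pushforward (lebesgue_measure \x m)%E (@tcons d).

HB.instance Definition _ := Measure.copy lebS
  (measure_function_pushforward__canonical__measure_function_Measure
    (lebesgue_measure \x m)%E (@measurable_tcons d)).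

Let lebS_sigma_finite : sigma_finite setT lebS.
Proof.
have /sigma_finiteP[F [FT ndF Foo]] := sigma_finiteT (@lebesgue_measure R).
have /sigma_finiteP[G [GT ndG Goo]] := sigma_finiteT m.
pose split (t : d.+1.-tuple RT) : RT * d.-tuple RT :=
  (thead t, [tuple of behead t]).
have msplit : measurable_fun setT split.
  by apply/measurable_fun_pairP; split;
    [exact: measurable_tnth|exact: measurable_behead].
exists (fun n => split @^-1` (F n `*` G n)) => [|n].
  apply/esym/seteqP; split=> // t _.
  have [i _ Fi] : (\bigcup_i F i) (split t).1 by rewrite -FT.
  have [j _ Gj] : (\bigcup_i G i) (split t).2 by rewrite -GT.
  exists (maxn i j) => //; split.
    by move: Fi; exact/subsetPset/ndF/leq_maxl.
  by move: Gj; exact/subsetPset/ndG/leq_maxr.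
have [mF Fnoo] := Foo n; have [mG Gnoo] := Goo n.
split.
  by rewrite -[X in measurable X]setTI; apply: msplit => //; exact: measurableX.
rewrite /lebS /pushforward (_ : _ @^-1` _ = F n `*` G n).
  by rewrite product_measure1E// lte_mul_pinfty// ge0_fin_numE.
by apply/seteqP; split=> -[x t]/=; rewrite /split/= theadE;
  rewrite (_ : [tuple of _] = t)//; exact: val_inj.
Qed.

HB.instance Definition _ :=
  Measure_isSigmaFinite.Build _ _ _ lebS lebS_sigma_finite.

End lebS.

Fixpoint leb (d : nat) : {sigma_finite_measure set (d.-tuple RT) -> \bar R} :=
  match d with
  | 0 => dirac [tuple]
  | d'.+1 => lebS (leb d')
  end.

(* With sigma-finiteness this characterises d-dimensional Lebesgue measure on
   the Borel (product) sigma-algebra. *)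
Lemma leb_box (d : nat) (B : 'I_d -> set RT) :
  (forall i, measurable (B i)) ->
  leb d [set t | forall i, B i (tnth t i)] =
  (\prod_(i < d) lebesgue_measure (B i))%E.
Proof.
elim: d B => [|d IH] B mB /=.
  by rewrite big_ord0 diracE mem_set// => -[].
rewrite big_ord_recl -(IH (fun i => B (lift ord0 i)))//.
pose D := [set t : d.-tuple RT | forall i, B (lift ord0 i) (tnth t i)].
rewrite /lebS /pushforward (_ : _ @^-1` _ = B ord0 `*` D).
  rewrite product_measure1E//.
  rewrite (_ : D = \big[setI/setT]_(i < d) ((@tnth d RT ^~ i) @^-1` B (lift ord0 i))).
    by apply: bigsetI_measurable => i _; rewrite -[X in measurable X]setTI;
      exact: measurable_tnth.
  rewrite -bigcap_seq; apply/seteqP; split=> t /= h i; first by move=> _; exact: h.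
  by apply: h; rewrite /= mem_index_enum.
apply/seteqP; split=> -[x t] /=.
  by move=> h; split=> [|i]; [exact: (h ord0)|have := h (lift ord0 i); rewrite tnthS].
move=> [h0 h] i; case: (unliftP ord0 i) => [j ->|->]; first by rewrite tnthS; exact: h.
by rewrite tnth0.
Qed.

End lebesgue_tuple.

Section wave_packets.
Context {R : realType}.

Definition expC (z : R[i]) : R[i] :=
  (expR (complex.Re z))%:C * (cos (complex.Im z) +i* sin (complex.Im z)).

Definition toC m n (M : 'M[R]_(m, n)) : 'M[R[i]]_(m, n) :=
  map_mx (fun x : R => x%:C) M.

Definition Immx m n (M : 'M[R[i]]_(m, n)) : 'M[R]_(m, n) :=
  map_mx (@complex.Im R) M.

Variable d : nat.
Implicit Types (u : 'cV[R]_d -> R[i]) (A : 'cV[R]_d -> 'cV[R]_d).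
Implicit Types (q p v x : 'cV[R]_d) (C P Q Y : 'M[R[i]]_d) (zeta : R[i]).

Definition posdefmx (M : 'M[R]_d) : Prop :=
  forall x, x != 0 -> 0 < (x^T *m M *m x) 0 0.

Definition L2norm u : \bar R :=
  Lnorm (leb d) 2%:E (fun t => (Normc.normc (u (colt t)))%:E).

(* <a>_u is not divided by the squared norm of u. [\int] is real-valued, with
   junk value 0 when the Lebesgue integral is infinite or undefined. *)
Definition average (a : 'cV[R]_d -> R) u : R :=
  \int[leb d]_t (a (colt t) * Normc.normc (u (colt t)) ^+ 2).

Definition average_vec A u : 'cV[R]_d := \col_k average (fun x => A x k 0) u.

(* Row k, column l is d_l A_k: this is the transpose of what the library's
   row-vector ['J A x] would give. *)
Definition jacobi A x : 'M[R]_d :=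
  \matrix_(k, l) 'D_(delta_mx l 0) (fun y => A y k 0) x.

Definition average_jacobi A u : 'M[R]_d :=
  \matrix_(k, l) average (fun x => jacobi A x k l) u.

Definition gaussian (eps : R) q p C zeta x : R[i] :=
  expC ('i%C / eps%:C *
    (2^-1 * ((toC (x - q))^T *m C *m toC (x - q)) 0 0 +
     ((toC (x - q))^T *m toC p) 0 0 + zeta)).

(* The last equation follows from the others; it belongs to the customary
   presentation of the parametrisation. *)
Definition hagedorn C Q P : Prop :=
  [/\ Q \in unitmx, P \in unitmx,
      Q^T *m P - P^T *m Q = 0,
      Q^t* *m P - P^t* *m Q = (2 * 'i%C)%:M &
      C = P *m invmx Q /\ toC (Immx C) = invmx (Q *m Q^t*)].

(* [wave_packet eps A u q v Q Y zeta]: u is a Gaussian wave packet whose magnetic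
   parameters are (q, v, Q, Upsilon, zeta), Upsilon being written Y. The averages
   defining v and Y are taken in u itself. *)
Definition wave_packet (eps : R) A u q v Q Y zeta : Prop :=
  exists p C P,
    [/\ C^T = C, posdefmx (Immx C), hagedorn C Q P,
        u = gaussian eps q p C zeta &
        v = p - average_vec A u /\ Y = P - toC (average_jacobi A u) *m Q].

End wave_packets.

(* Main.v *)
(** Since p is real, |u(x)|^2 = exp(- 2 zeta_I / eps) exp(- (x - q)^T (C_I / eps) (x - q)),
    and det C_I = |det Q|^-2, so that
    ||u||^2 = exp(- 2 zeta_I / eps) |det Q| (pi eps)^(d/2);
    comparing logarithms gives the equivalence. The Gaussian integral over R^d is
    computed by induction on d: completing the square in the first coordinate
    leaves, after integrating it out, the Gaussian of the Schur complement. *)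

Require Import Defs.
From mathcomp Require Import all_boot all_order all_algebra.
From mathcomp Require Import complex.
From mathcomp Require Import all_classical all_reals all_analysis.
From mathcomp Require Import measurable_realfun ring.

Set Implicit Arguments.
Unset Strict Implicit.
Unset Printing Implicit Defensive.

Import Order.TTheory GRing.Theory Num.Theory.
Import numFieldNormedType.Exports.
Local Open Scope ring_scope.
Local Open Scope complex_scope.

(** * Real quadratic forms and Schur complements *)

Section quadratic_forms.
Context {R : realType}.

Definition qform n (S : 'M[R]_n) (y : 'cV[R]_n) : R := (y^T *m S *m y) 0 0.

Lemma qformZ n (S : 'M[R]_n) y k : qform (k *: S) y = k * qform S y.
Proof. by rewrite /qform -scalemxAr -scalemxAl mxE. Qed.

Lemma measurable_qform n (S : 'M[R]_n) c :
  measurable_fun setT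
    (fun t : n.-tuple (measurableTypeR R) => qform S (colt t - c)).
Proof.
rewrite /qform; under eq_fun do rewrite mxE.
apply: measurable_sum => i; apply: measurable_funM; last first.
  under eq_fun do rewrite !mxE.
  by apply: measurable_funD => //; exact: measurable_tnth.
under eq_fun do rewrite mxE.
apply: measurable_sum => j; apply: measurable_funM => //.
under eq_fun do rewrite !mxE.
by apply: measurable_funD => //; exact: measurable_tnth.
Qed.

(* Only meaningful for symmetric [S]: the top-right block is taken to be the
   transpose of the bottom-left one. *)
Definition schur n (S : 'M[R]_(1 + n)) : 'M[R]_n :=
  drsubmx S - (S 0 0)^-1 *: (dlsubmx S *m (dlsubmx S)^T).

Lemma sym_block n (S : 'M[R]_(1 + n)) : S^T = S ->
  S = block_mx (S 0 0)%:M (dlsubmx S)^T (dlsubmx S) (drsubmx S).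
Proof.
move=> symS; rewrite -{1}[S]submxK trmx_dlsub symS; congr block_mx.
by rewrite [LHS]mx11_scalar !mxE lshift0.
Qed.

(** Completing the square in [x]: with [a] the corner entry and [s] the product of [b^T] and [y],
    the cross terms are [2 * x * s], and the surplus [s ^+ 2 / a] of the square is exactly what the
    Schur complement subtracts. *)
Lemma qform_schur n (S : 'M[R]_(1 + n)) x y : S^T = S -> S 0 0 != 0 ->
  qform S (col_mx x%:M y) =
  S 0 0 * (x + ((dlsubmx S)^T *m y) 0 0 / S 0 0) ^+ 2 + qform (schur S) y.
Proof.
move=> symS a0; rewrite /qform /schur {1}(sym_block symS).
set a := S 0 0 in a0 *; set b := dlsubmx S; set D := drsubmx S.
set s := (b^T *m y) 0 0.
have by_ : b^T *m y = s%:M by rewrite [LHS]mx11_scalar.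
have yb : y^T *m b = s%:M by rewrite -[b]trmxK -trmx_mul by_ tr_scalar_mx.
rewrite tr_col_mx mul_row_block mul_row_col tr_scalar_mx yb.
have ybby : y^T *m (b *m b^T) *m y = (s * s)%:M.
  by rewrite mulmxA yb -mulmxA by_ scalar_mxM.
rewrite mulmxBr mulmxBl -scalemxAr -scalemxAl ybby.
rewrite !mulmxDl -(mulmxA x%:M b^T) by_ -!scalar_mxM.
by set r := y^T *m D *m y; rewrite !mxE eqxx !mulr1n; field.
Qed.

Lemma det_schur n (S : 'M[R]_(1 + n)) : S^T = S -> S 0 0 != 0 ->
  \det S = S 0 0 * \det (schur S).
Proof.
move=> symS a0; rewrite {1}(sym_block symS) /schur.
set a := S 0 0 in a0 *; set b := dlsubmx S; set D := drsubmx S.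
(* Block Gaussian elimination: the left factor is unipotent and restores the column [b] below the
   pivot [a]. *)
have -> : block_mx a%:M b^T b D =
    block_mx 1%:M 0 (a^-1 *: b) 1%:M *m
    block_mx a%:M b^T 0 (D - a^-1 *: (b *m b^T)).
  rewrite mulmx_block !mul1mx !mul0mx !addr0 mul_mx_scalar scalerA.
  by rewrite mulfV// scale1r -scalemxAl addrC subrK.
by rewrite det_mulmx det_lblock det_ublock !det1 !mul1r det_scalar1.
Qed.

Lemma schur_tr n (S : 'M[R]_(1 + n)) : S^T = S -> (schur S)^T = schur S.
Proof.
move=> symS; rewrite /schur linearB/= linearZ/= trmx_mul trmxK.
by rewrite trmx_drsub symS.
Qed.

Lemma posdefmx_ul n (S : 'M[R]_(1 + n)) : S^T = S -> posdefmx S -> 0 < S 0 0.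
Proof.
move=> symS pS; have := pS (col_mx 1%:M 0).
have -> : ((col_mx 1%:M 0)^T *m S *m col_mx 1%:M 0) 0 0 = S 0 0.
  rewrite {1}(sym_block symS) tr_col_mx mul_row_block mul_row_col.
  by rewrite trmx0 !mul0mx !mulmx0 tr_scalar_mx mul1mx mulmx1 !addr0 !mxE eqxx.
apply; apply/eqP; rewrite -col_mx0 => /eq_col_mx[/matrixP/(_ 0 0)].
by rewrite !mxE eqxx => /eqP; rewrite oner_eq0.
Qed.

Lemma posdefmx_schur n (S : 'M[R]_(1 + n)) : S^T = S -> posdefmx S ->
  posdefmx (schur S).
Proof.
move=> symS pS y y0; have a0 := posdefmx_ul symS pS.
(* This [x] makes the completed square vanish, so that [S] at [col_mx x%:M y] takes the value of the
   Schur complement at [y]. *)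
pose x := - (((dlsubmx S)^T *m y) 0 0 / S 0 0).
have := pS (col_mx x%:M y).
rewrite -/(qform _ _) qform_schur ?gt_eqF// addNr expr0n mulr0 add0r; apply.
by apply: contraNN y0 => /eqP; rewrite -col_mx0 => /eq_col_mx[_ ->].
Qed.

(** The determinant is the product of the pivots met in repeated Schur complementation, each of them
    positive. *)
Lemma posdefmx_det_gt0 n (S : 'M[R]_n) : S^T = S -> posdefmx S -> 0 < \det S.
Proof.
elim: n S => [|n IH] S symS pS; first by rewrite det_mx00.
have a0 := posdefmx_ul symS pS.
rewrite det_schur ?gt_eqF// mulr_gt0//.
by apply: IH; [exact: schur_tr|exact: posdefmx_schur].
Qed.

End quadratic_forms.

(** * The Gaussian integral, first on the line, then in dimension n *)

Section gaussian_integral.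
Context {R : realType}.

Lemma integral_gauss_line (a c : R) : 0 < a ->
  (\int[lebesgue_measure]_x (expR (- (a * (x - c) ^+ 2)))%:E)%E =
  (Num.sqrt (pi / a))%:E.
Proof.
(* The normal law with mean [c] and variance [1 / (2 * a)] has the required exponent; its total mass
   1 then gives the integral. *)
move=> a0; pose s := Num.sqrt (2 * a)^-1.
have s2 : s ^+ 2 = (2 * a)^-1 by rewrite sqr_sqrtr// invr_ge0 mulr_ge0// ltW.
have s0 : s != 0 by rewrite gt_eqF// sqrtr_gt0 invr_gt0 mulr_gt0.
have pE : normal_peak s = (Num.sqrt (pi / a))^-1.
  rewrite /normal_peak s2; congr (Num.sqrt _)^-1; rewrite -mulr_natr; field.
  by rewrite gt_eqF.
transitivity (\int[lebesgue_measure]_x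
    ((Num.sqrt (pi / a))%:E * (normal_pdf c s x)%:E))%E.
  apply: eq_integral => x _; rewrite normal_pdfE// -EFinM pE mulVKf.
    rewrite /normal_fun s2; congr (expR _)%:E; rewrite -mulr_natr; field.
    by rewrite gt_eqF.
  by rewrite gt_eqF// sqrtr_gt0 divr_gt0// pi_gt0.
rewrite ge0_integralZl//.
- by rewrite integral_normal_pdf mule1.
- by apply/measurable_EFinP; exact: measurable_normal_pdf.
- by move=> x _; rewrite lee_fin normal_pdf_ge0.
Qed.

(** The induction runs over all [S] and [c], since its step passes to [schur S] and to the centre
    without its first coordinate. *)
Lemma integral_expR_qform n (S : 'M[R]_n) c : S^T = S -> posdefmx S ->
  (\int[leb n]_t (expR (- qform S (colt t - c)))%:E)%E =
  (Num.sqrt (pi ^+ n / \det S))%:E.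
Proof.
elim: n S c => [|n IH] S c symS pS.
  (* In dimension 0 the measure is a unit mass, the form is an empty sum and the determinant is
     1. *)
  rewrite [LHS]integral_dirac//.
    rewrite diracE in_setT mul1e /qform mxE big_ord0 oppr0 expR0.
    by rewrite det_mx00 divr1 sqrtr1.
  apply/measurable_EFinP; apply: measurableT_comp => //.
  by apply: measurableT_comp => //; exact: measurable_qform.
have a0 := posdefmx_ul symS pS.
set f := fun t => _.
have mf : measurable_fun setT f.
  apply/measurable_EFinP; apply: measurableT_comp => //.
  by apply: measurableT_comp => //; exact: measurable_qform.
have f0 t : (0 <= f t)%E by rewrite lee_fin expR_ge0.
transitivity (\int[lebesgue_measure \x leb n]_xt f (tcons xt))%E.
  have := @ge0_integral_pushforward _ _ _ _ R _ (@measurable_tcons R n)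
    (lebesgue_measure \x leb n)%E setT f measurableT mf (fun t _ => f0 t).
  by rewrite preimage_setT => <-.
(* Tonelli with the first coordinate as the inner variable. *)
rewrite fubini_tonelli2//; last first.
  by apply: measurableT_comp => //; exact: measurable_tcons.
pose d : 'cV[R]_n := dsubmx (c : 'cV[R]_(1 + n)).
pose e (t : n.-tuple (measurableTypeR R)) :=
  (expR (- qform (schur S) (colt t - d)))%:E.
transitivity (\int[leb n]_t ((Num.sqrt (pi / S 0 0))%:E * e t))%E.
  apply: eq_integral => t _; rewrite /fubini_G.
  (* The remaining coordinates [t] only shift the centre of the inner Gaussian, by [- s], so the
     inner integral contributes a factor independent of [t]. *)
  pose s := ((dlsubmx (S : 'M[R]_(1 + n)))^T *m (colt t - d)) 0 0 / S 0 0.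
  rewrite -(integral_gauss_line (c 0 0 - s) a0).
  rewrite -ge0_integralZr//.
  - apply: eq_integral => x _; rewrite /f /e -EFinM -expRD -opprD.
    congr (expR (- _))%:E.
    have -> : colt (tcons (x, t)) - c =
        col_mx (x - c 0 0)%:M (colt t - d) :> 'cV[R]_(1 + n).
      apply/colP => i; rewrite !mxE; case: splitP => j ij.
        rewrite (ord1 j) in ij *; rewrite !mxE eqxx mulr1n.
        by rewrite (_ : i = 0) ?tnth0//; exact: val_inj.
      have -> : i = lift ord0 j by exact: val_inj.
      by rewrite !mxE tnthS rshift1.
    rewrite qform_schur ?gt_eqF//; congr (S 0 0 * _ ^+ 2 + _).
    by rewrite opprB addrA addrAC.
  - apply/measurable_EFinP; apply: measurableT_comp => //.
    apply: measurableT_comp => //; apply: measurable_funM => //.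
    by apply: measurable_funX; exact: measurable_funB.
  - by rewrite lee_fin expR_ge0.
rewrite ge0_integralZl//.
- rewrite IH; [|exact: schur_tr|exact: posdefmx_schur].
  rewrite -EFinM -sqrtrM ?divr_ge0 ?pi_ge0 ?(ltW a0)//.
  by rewrite (@det_schur _ n) ?gt_eqF// invfM mulrACA exprS.
- apply/measurable_EFinP; apply: measurableT_comp => //.
  by apply: measurableT_comp => //; exact: measurable_qform.
- by move=> t _; rewrite lee_fin expR_ge0.
Qed.

End gaussian_integral.

(** * Modulus and norm of a wave packet *)

Section wave_packet_norm.
Context {R : realType}.

Lemma normc_ge0 (z : R[i]) : 0 <= Normc.normc z.
Proof. by case: z => a b; exact: sqrtr_ge0. Qed.

Lemma normc_real (x : R) : Normc.normc x%:C = `|x|.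
Proof. by rewrite /Normc.normc/= expr0n addr0 sqrtr_sqr. Qed.

Lemma normc_conj (z : R[i]) : Normc.normc z^* = Normc.normc z.
Proof. by case: z => a b; rewrite /Normc.normc/= sqrrN. Qed.

Lemma normc_expC (z : R[i]) : Normc.normc (expC z) = expR (complex.Re z).
Proof.
rewrite /expC Normc.normcM normc_real ger0_norm ?expR_ge0//.
by rewrite /Normc.normc/= cos2Dsin2 sqrtr1 mulr1.
Qed.

Lemma ImMl (x : R) (z : R[i]) : complex.Im (x%:C * z) = x * complex.Im z.
Proof. by case: z => a b; rewrite /= mul0r addr0. Qed.

Lemma ImmxE m n (M : 'M[R[i]]_(m, n)) i j : Immx M i j = complex.Im (M i j).
Proof. exact: mxE. Qed.

(** The imaginary part is real-linear, hence commutes with multiplication by a real matrix. *)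
Lemma Immx_toCl m n p (M : 'M[R]_(m, n)) (N : 'M[R[i]]_(n, p)) :
  Immx (toC M *m N) = M *m Immx N.
Proof.
apply/matrixP => i j; rewrite !mxE raddf_sum; apply: eq_bigr => k _.
by rewrite !mxE; exact: ImMl.
Qed.

Lemma Immx_tr m n (M : 'M[R[i]]_(m, n)) : Immx M^T = (Immx M)^T.
Proof. by apply/matrixP => i j; rewrite !mxE. Qed.

Lemma toC_tr m n (M : 'M[R]_(m, n)) : (toC M)^T = toC M^T.
Proof. by rewrite /toC map_trmx. Qed.

Lemma Immx_toCr m n p (M : 'M[R[i]]_(m, n)) (N : 'M[R]_(n, p)) :
  Immx (M *m toC N) = Immx M *m N.
Proof.
by apply: trmx_inj; rewrite -Immx_tr !trmx_mul toC_tr Immx_toCl Immx_tr.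
Qed.

Lemma Immx_toC m n (M : 'M[R]_(m, n)) : Immx (toC M) = 0.
Proof. by apply/matrixP => i j; rewrite !mxE. Qed.

Variable d : nat.

Lemma normc_gaussian_sqr (eps : R) q p (C : 'M[R[i]]_d) zeta x :
  Normc.normc (gaussian eps q p C zeta x) ^+ 2 =
  expR (- (2 / eps * complex.Im zeta)) *
  expR (- qform (eps^-1 *: Immx C) (x - q)).
Proof.
rewrite /gaussian normc_expC expr2 -!expRD; congr expR.
set w := (2^-1 * _ + _ + _).
(* The factor i turns the real part of the exponent into minus the imaginary part of the phase
   [w]. *)
have -> : complex.Re ('i%C / eps%:C * w) = - (eps^-1 * complex.Im w).
  rewrite -mulrA -fmorphV/= -[in RHS]ImMl; case: (_ * w) => a b /=.
  by rewrite mul0r mul1r add0r.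
have -> : complex.Im w = 2^-1 * qform (Immx C) (x - q) + complex.Im zeta.
  rewrite /w !raddfD/= (_ : 2^-1 = (2^-1 : R)%:C :> R[i]); last first.
    by rewrite fmorphV rmorph_nat.
  rewrite ImMl !toC_tr /qform -Immx_toCl -Immx_toCr ImmxE.
  (* The term linear in [x - q] is real because [p] is, so it contributes nothing to the modulus. *)
  rewrite -[in X in _ + X + _]ImmxE Immx_toCl Immx_toC mulmx0.
  by rewrite [X in _ + X + _]mxE addr0.
by rewrite qformZ; set e := eps^-1; field.
Qed.

(** Comparing moduli of determinants suffices: the left one is positive, and conjugate transposition
    preserves the modulus of [\det Q]. *)
Lemma det_Immx (C Q : 'M[R[i]]_d) : 0 < \det (Immx C) ->
  toC (Immx C) = invmx (Q *m (Q^t*)%sesqui) ->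
  \det (Immx C) = (Normc.normc (\det Q) ^+ 2)^-1.
Proof.
move=> C0 /(congr1 (fun M => Normc.normc (\det M))).
rewrite det_map_mx normc_real gtr0_norm// => ->.
by rewrite det_inv Normc.normcV det_mulmx det_map_mx det_tr Normc.normcM normc_conj.
Qed.

Lemma normc_det_gt0 (Q : 'M[R[i]]_d) : Q \in unitmx -> 0 < Normc.normc (\det Q).
Proof.
rewrite unitmxE unitfE => Q0; rewrite lt_neqAle normc_ge0 andbT eq_sym.
by apply: contraNN Q0 => /eqP/Normc.eq0_normc ->.
Qed.

Lemma L2norm_sqr (u : 'cV[R]_d -> R[i]) :
  (L2norm u `^ 2 = \int[leb d]_t (Normc.normc (u (colt t)) ^+ 2)%:E)%E.
Proof.
rewrite poweR_Lnorm//; apply: eq_integral => t _.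
by rewrite gee0_abs ?lee_fin ?normc_ge0// poweR_EFin powR_mulrn// normc_ge0.
Qed.

(** Norms are nonnegative extended reals, on which the power [2^-1] undoes squaring. *)
Lemma L2norm_inj (u0 u1 : 'cV[R]_d -> R[i]) :
  L2norm u0 = L2norm u1 <-> (L2norm u0 `^ 2 = L2norm u1 `^ 2)%E.
Proof.
split=> [->//|/(congr1 (fun x => x `^ 2^-1)%E)].
by rewrite -!poweRrM mulfV ?pnatr_eq0// !poweRe1 ?Lnorm_ge0.
Qed.

(** Gaussian integral for [S], the imaginary part of [C] divided by [eps]: its determinant is
    [eps ^- d] over the squared modulus of [\det Q]. *)
Lemma L2norm_wave_packet (eps : R) A (u : 'cV[R]_d -> R[i]) q v Q Y zeta :
  0 < eps -> wave_packet eps A u q v Q Y zeta ->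
  (L2norm u `^ 2 = (expR (- (2 / eps * complex.Im zeta)) *
    (Normc.normc (\det Q) * Num.sqrt ((pi * eps) ^+ d)))%:E)%E.
Proof.
move=> e0 [p [C [P [symC pC [uQ _ _ _ [_ CQ]] -> _]]]].
pose S := eps^-1 *: Immx C.
have symI : (Immx C)^T = Immx C by rewrite -Immx_tr symC.
have symS : S^T = S by rewrite /S linearZ/= symI.
have pS : posdefmx S.
  by move=> x x0; rewrite -/(qform _ _) qformZ mulr_gt0 ?invr_gt0//; exact: pC.
have dQ := det_Immx (posdefmx_det_gt0 symI pC) CQ.
rewrite L2norm_sqr; under eq_integral do rewrite normc_gaussian_sqr EFinM.
rewrite ge0_integralZl//.
- rewrite integral_expR_qform// -EFinM; congr (_ * _)%:E.
  (* The modulus of [\det Q] is written as the root of its square, to merge it with the other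
     root. *)
  rewrite -[Normc.normc _]ger0_norm ?normc_ge0// -sqrtr_sqr.
  rewrite -sqrtrM ?sqr_ge0//.
  congr Num.sqrt; rewrite detZ dQ exprVn -invfM invrK exprMn; ring.
- apply/measurable_EFinP; apply: measurableT_comp => //.
  by apply: measurableT_comp => //; exact: measurable_qform.
Qed.

End wave_packet_norm.

(** * Comparing the norms of two wave packets *)

Theorem lemma5p1 (R : realType) (d : nat) (hd : (1 <= d)%N)
  (eps : R) (heps : 0 < eps) (A : 'cV[R]_d -> 'cV[R]_d)
  (u0 u1 : 'cV[R]_d -> R[i]) (q0 v0 q1 v1 : 'cV[R]_d)
  (Q0 Y0 Q1 Y1 : 'M[R[i]]_d) (zeta0 zeta1 : R[i])
  (hu0 : wave_packet eps A u0 q0 v0 Q0 Y0 zeta0)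
  (hu1 : wave_packet eps A u1 q1 v1 Q1 Y1 zeta1) :
  complex.Im zeta1 = complex.Im zeta0 +
    eps / 2 * (ln (Normc.normc (\det Q1)) - ln (Normc.normc (\det Q0)))
  <-> L2norm u0 = L2norm u1.
Proof.
have Q0_gt0 : 0 < Normc.normc (\det Q0).
  have [p [C [P [_ _ [uQ _ _ _ _] _ _]]]] := hu0; exact: normc_det_gt0.
have Q1_gt0 : 0 < Normc.normc (\det Q1).
  have [p [C [P [_ _ [uQ _ _ _ _] _ _]]]] := hu1; exact: normc_det_gt0.
rewrite L2norm_inj (L2norm_wave_packet heps hu0) (L2norm_wave_packet heps hu1).
rewrite !mulrA; set c := Num.sqrt _.
have c0 : c != 0 by rewrite gt_eqF// sqrtr_gt0 exprn_gt0// mulr_gt0 ?pi_gt0.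
(* Occurrence 1 of each modulus lies inside the logarithm of the relation; occurrence 2, in the
   squared norm, becomes the exponential of its logarithm, so each side is one exponential times
   [c]. *)
rewrite -{2}(lnK Q0_gt0) -{2}(lnK Q1_gt0) -!expRD.
set l1 := ln _; set l0 := ln _.
set z1 := complex.Im zeta1; set z0 := complex.Im zeta0.
split=> [->|[/(mulIf c0)/expR_inj]].
  by congr (expR _ * _)%:E; field; rewrite gt_eqF.
(* Equality of the exponents, solved for [l1]; substituting it turns the relation into an
   identity. *)
move=> h; have -> : l1 = l0 - 2 / eps * z0 + 2 / eps * z1.
  by rewrite -[LHS](addKr (- (2 / eps * z1))) -h; ring.
by field; rewrite gt_eqF.
Qed.
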